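(* The space $C_p(\omega_1,\{0,1\}^\omega)$ admits a continuous injection into $C_p(\omega_1+1,\{0,1\}^\omega)$, but $C_p(\omega_1,\{0,1\}^\omega)$ is not homeomorphic to any subspace of $C_p(\omega_1+1,\{0,1\}^\omega)$.
   Context: Ordinals carry the order topology. $C_p(X,Y)$ is the set of all continuous maps $X\to Y$ with the topology of pointwise convergence (the subspace topology from the product $Y^X$). $\{0,1\}$ is discrete and $\{0,1\}^\omega$ has the product topology. *)

(* Defs.v *)
From HB Require Import structures.
From mathcomp Require Import all_boot all_order.
From mathcomp Require Import all_classical topology cantor.
From mathcomp Require wochoice.

Set Implicit Arguments.
Unset Strict Implicit.
Unset Printing Implicit Defensive.

Import Order.TTheory.
Local Open Scope classical_set_scope.
Local Open Scope order_scope.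

(* omega_1 is realised inside a well-ordering of the uncountable type
   nat -> bool, as the initial segment of the points that have only countably
   many predecessors. Lemmas omega1_min, omega1_uncountable and
   omega1_countable_initial below characterise it up to isomorphism as the
   least uncountable well-order. *)
Definition binseq_wo : rel (nat -> bool) :=
  sval (wochoice.well_ordering_principle (nat -> bool)).

Definition omega1_carrier : set (nat -> bool) :=
  [set x | countable [set y | binseq_wo y x /\ y != x]].

Definition omega1 : Type := omega1_carrier.

HB.instance Definition _ := Choice.on omega1.

Section omega1_order.

Let woP : wochoice.well_order binseq_wo := svalP (wochoice.well_ordering_principle _).

Let wo_min (A : set (nat -> bool)) : A !=set0 ->
  exists2 z, A z & forall y, A y -> binseq_wo z y.
Proof.
case=> x Ax; have [|z [[zA zmin] _]] := woP (A := mem A).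
  by exists x; rewrite inE.
exists z; first by move: zA; rewrite inE.
by move=> y Ay; apply: zmin; rewrite inE.
Qed.

Let wo_refl : reflexive binseq_wo.
Proof.
move=> x; have [|z -> zmin] := wo_min (A := [set x]); first by exists x.
exact: zmin.
Qed.

Let wo_anti : antisymmetric binseq_wo.
Proof.
move=> x y /andP[xy yx].
have [|z [_ zuniq]] := woP (A := [in [set x; y]]).
  by exists x; rewrite inE; left.
rewrite -(zuniq x) ?(zuniq y)//; split=> [|w]; rewrite !inE /=.
- by right.
- by case=> ->.
- by left.
- by case=> ->.
Qed.

Let wo_total : total binseq_wo.
Proof.
move=> x y; have [|z [->|->] zmin] := wo_min (A := [set x; y]).
- by exists x; left.
- by rewrite (zmin y) //; right.
- by rewrite (zmin x) ?orbT//; left.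
Qed.

Let wo_trans : transitive binseq_wo.
Proof.
move=> y x z xy yz.
have [|w [[->|->]|->] wmin] := wo_min (A := [set x; y] `|` [set z]).
- by exists x; left; left.
- by apply: wmin; right.
- have yx : binseq_wo y x by apply: wmin; left; left.
  by rewrite (wo_anti (x := x) (y := y)) ?xy ?yx.
- have zy : binseq_wo z y by apply: wmin; left; right.
  by rewrite -(wo_anti (x := y) (y := z)) ?yz ?zy.
Qed.

Definition omega1_le : rel omega1 := fun x y => binseq_wo (val x) (val y).

Let omega1_le_refl : reflexive omega1_le.
Proof. by move=> x; exact: wo_refl. Qed.

Let omega1_le_anti : antisymmetric omega1_le.
Proof. by move=> x y /wo_anti /val_inj. Qed.

Let omega1_le_trans : transitive omega1_le.
Proof. by move=> y x z; exact: wo_trans. Qed.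

Let omega1_le_total : total omega1_le.
Proof. by move=> x y; exact: wo_total. Qed.

HB.instance Definition _ := Order.Le_isPOrder.Build Order.default_display omega1
  omega1_le_refl omega1_le_anti omega1_le_trans.

HB.instance Definition _ :=
  Order.POrder_isTotal.Build Order.default_display omega1 omega1_le_total.

Lemma omega1_min (A : set omega1) : A !=set0 ->
  exists2 x, A x & forall y, A y -> x <= y.
Proof.
case=> a Aa; have [|z [x Ax <-] xmin] := wo_min (A := val @` A).
  by exists (val a), a.
by exists x => // y Ay; apply: xmin; exists y.
Qed.

Let binseq_uncountable : ~ countable [set: nat -> bool].
Proof.
case/pcard_surjP=> g /(_ (fun n => ~~ g n n) I)[n _ /(congr1 (@^~ n))].
by case: (g n n).
Qed.

Lemma omega1_uncountable : ~ countable [set: omega1].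
Proof.
move=> omega1C.
have carC : countable omega1_carrier.
  suff -> : omega1_carrier = val @` [set: omega1] by
    exact: card_le_trans (card_image_le _ _) omega1C.
  apply/seteqP; split=> [x xA|_ [x _ <-]]; last exact: set_valP.
  by exists (exist _ x (mem_set xA) : omega1).
have [|z zA zmin] := wo_min (A := ~` omega1_carrier).
  apply/set0P/negP => /eqP A0; apply: binseq_uncountable.
  by rewrite -[setT]setC0 -A0 setCK.
apply: zA; apply: sub_countable carC; apply: subset_card_le => y [yz ynz].
apply: contrapT => /zmin zy; move/eqP: ynz; apply.
by apply: wo_anti; rewrite yz zy.
Qed.

Lemma omega1_countable_initial (x : omega1) : countable [set y | y < x].
Proof.
have xA : omega1_carrier (val x) := set_valP x.
apply/countable_injP; case/countable_injP: xA => f finj.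
exists (f \o val) => y z; rewrite !inE/= => yx zx fyz; apply: val_inj.
have pred w : w < x -> binseq_wo (val w) (val x) /\ val w != val x.
  by move=> wx; split; [exact: ltW wx|rewrite (inj_eq val_inj) (lt_eqF wx)].
by apply: finj fyz; rewrite inE; exact: pred.
Qed.

End omega1_order.

(* The order T + 1: T followed by one further point None. *)
Definition order_succ (T : Type) : Type := option T.

Section order_succ_order.
Context {d : Order.disp_t} {T : orderType d}.

HB.instance Definition _ := Choice.on (order_succ T).

Definition order_succ_le : rel (order_succ T) := fun x y =>
  match x, y with
  | Some a, Some b => a <= b
  | _, None => true
  | None, Some _ => false
  end.

Let order_succ_le_refl : reflexive order_succ_le.
Proof. by case=> [a|] /=. Qed.

Let order_succ_le_anti : antisymmetric order_succ_le.
Proof. by case=> [a|] [b|] //= /le_anti ->. Qed.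

Let order_succ_le_trans : transitive order_succ_le.
Proof. by case=> [a|] [b|] [c|] //=; exact: le_trans. Qed.

Let order_succ_le_total : total order_succ_le.
Proof. by case=> [a|] [b|] //=; exact: le_total. Qed.

HB.instance Definition _ := Order.Le_isPOrder.Build d (order_succ T)
  order_succ_le_refl order_succ_le_anti order_succ_le_trans.

HB.instance Definition _ :=
  Order.POrder_isTotal.Build d (order_succ T) order_succ_le_total.

End order_succ_order.

(* Used as a type, a set of a topological space carries the subspace topology;
   for Cp X Y it is the one induced by the product topology on Y^X. *)
Definition Cp (X Y : topologicalType) : set {ptws X -> Y} :=
  [set f | continuous (f : X -> Y)].
Arguments Cp : clear implicits.

Definition homeomorphic (X Y : topologicalType) : Prop :=
  exists (f : X -> Y) (g : Y -> X),
    [/\ cancel f g, cancel g f, continuous f & continuous g].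

(* Main.v *)
Require Import Defs.
From mathcomp Require Import all_boot all_order interval.
From mathcomp Require Import all_classical topology cantor.

(* The injection replaces a function by its jumps f(x) + f(x - 1) at successor
   points, keeps f(0), and puts 0 at limits and at the top: continuity at limits
   makes f eventually constant below each of them, so the result is continuous,
   and f is recovered by transfinite induction.

   Countable tightness separates the two spaces. All finite powers of the
   compact space omega_1 + 1 are compact, so its function space is countably
   tight, as are all the subspaces of the latter. Over omega_1 the zero function
   is in the closure of the indicators of the tails ]a, oo[, but not in the
   closure of countably many of them. *)

Set Implicit Arguments.
Unset Strict Implicit.
Unset Printing Implicit Defensive.

Import Order.TTheory.
Local Open Scope classical_set_scope.
Local Open Scope order_scope.

(** * Countable tightness and its passage to subspaces *)

Definition countably_tight (T : topologicalType) : Prop :=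
  forall (A : set T) (x : T), closure A x ->
    exists B : set T, [/\ B `<=` A, countable B & closure B x].

(** A countable subset of the image of [A] in [Z] pulls back injectively to a countable subset of
    [A]; continuity of the inverse [k] keeps [x] in its closure. *)
Lemma countably_tight_subspace (Z : topologicalType) (S : set Z)
    (X : topologicalType) :
  countably_tight Z -> homeomorphic X S -> countably_tight X.
Proof.
move=> Ztight [h [k [hK kK hcont kcont]]] A x clAx.
pose e (a : X) : Z := set_val (h a).
have einj : injective e by move=> a b /val_inj /(can_inj hK).
have econt : continuous e.
  move=> a; apply: continuous_comp; first exact: hcont.
  exact: initial_continuous.
have [|C [CA Cct clC]] := Ztight (e @` A) (e x).
  by move=> U /econt /clAx[a [Aa Ua]]; exists (e a); split => //; exists a.
exists (A `&` e @^-1` C); split; first exact: subIsetl.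
  move/countable_injP: Cct => [f finj]; apply/countable_injP.
  exists (f \o e) => a b; rewrite !inE => -[_ Ca] [_ Cb] /= fab.
  by apply/einj/finj; rewrite ?inE.
move=> U Ux; have : nbhs (h x) (k @^-1` U) by apply: kcont; rewrite hK.
case=> _ [[W oW <-] /= Wx WU].
have [c [Cc Wc]] := clC W (open_nbhs_nbhs (conj oW Wx)).
have [a Aa eac] := CA _ Cc; exists a; split; first by split=> //; rewrite /= eac.
by rewrite -(hK a); apply: (WU (h a)); rewrite /= -/(e a) eac.
Qed.

(** * Function spaces over a compact domain *)

Lemma CpP (X Y : topologicalType) (f : Cp X Y) :
  continuous (set_val f : X -> Y).
Proof. by have := set_valP f. Qed.

Lemma Cp_eval_continuous (X Y : topologicalType) (x : X) :
  continuous (fun f : Cp X Y => (set_val f : X -> Y) x).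
Proof.
move=> f; apply: (@continuous_comp (Cp X Y) {ptws X -> Y} Y set_val (@^~ x)).
  exact: initial_continuous.
exact: (@proj_continuous X (fun=> Y) x).
Qed.

Lemma nbhs_Cp (X : topologicalType) (Y : uniformType) (f : Cp X Y)
    (U : set (Cp X Y)) :
  nbhs f U -> exists (s : seq X) (E : set (Y * Y)), entourage E /\
    forall g : Cp X Y,
      (forall x, x \in s -> E ((set_val f : X -> Y) x, (set_val g : X -> Y) x)) ->
      U g.
Proof.
pose basic (i : seq X * set (Y * Y)) := [set g : Cp X Y |
  forall x, x \in i.1 -> i.2 ((set_val f : X -> Y) x, (set_val g : X -> Y) x)].
(* The claim says that [G] refines the neighbourhood filter of [f], which follows once [G] converges
   pointwise to [f]. *)
pose G := filter_from [set i : seq X * set (Y * Y) | entourage i.2] basic.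
have FG : Filter G.
  apply: filter_from_filter; first by exists ([::], setT); exact: entourageT.
  move=> [s E] [t D] /= entE entD; exists (s ++ t, E `&` D).
    exact: filterI.
  move=> g gst; split=> x xst; have [] // := gst x.
    by rewrite mem_cat xst.
  by rewrite mem_cat xst orbT.
suff GU : nbhs f `<=` G by move=> /GU[[s E] entE sEU]; exists s, E.
have Gval : (set_val @ G : set_system {ptws X -> Y}) --> (set_val f : {ptws X -> Y}).
  apply/pointwise_cvgP => x V /nbhsP[E entE EV].
  exists ([:: x], E) => // g gE; apply: EV; apply/xsectionP.
  by apply: gE; rewrite inE.
move=> V [_ [[W oW <-] Wf] WV]; apply: (filterS WV).
by apply: Gval; exact: open_nbhs_nbhs.
Qed.

(** Splitting [E] twice leaves room for the chain from [f y] to [f x], then [g x], then [g y]. *)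
Lemma near_entourage2 (X : topologicalType) (Y : uniformType) (f g : X -> Y)
    (x : X) (E : set (Y * Y)) : entourage E ->
  continuous f -> continuous g -> split_ent (split_ent E) (f x, g x) ->
  \forall y \near x, E (f y, g y).
Proof.
move=> entE fc gc Exy.
have entE2 : entourage (split_ent (split_ent E)) by [].
have nf : \forall y \near x, split_ent (split_ent E) (f y, f x).
  have := fc x _ (nbhs_entourage (f x) (entourage_inv entE2)).
  by apply: (@filterS _ (nbhs x)) => y /xsectionP.
have ng : \forall y \near x, split_ent E (g x, g y).
  have := gc x _ (nbhs_entourage (g x) (entourage_split_ent entE)).
  by apply: (@filterS _ (nbhs x)) => y /xsectionP.
apply: filterS2 nf ng => y fyx gxy; apply: (entourage_split (g x) entE) gxy.
exact: (entourage_split (f x) (entourage_split_ent entE) fyx).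
Qed.

(* By compactness of X^n, finitely many members of A approximate f, up to a
   given entourage, at all n-tuples of points of X simultaneously. *)
Lemma Cp_countably_tight (X : topologicalType) (Y : uniformType) :
  compact [set: X] -> countable_uniformity Y -> countably_tight (Cp X Y).
Proof.
move=> cX /countable_uniformityP[E Ebase entE] A f clAf.
pose ev (g : Cp X Y) : X -> Y := set_val g.
pose close D (n : nat) (x : {ptws 'I_n -> X}) (g : Cp X Y) :=
  forall k, D (ev f (x k), ev g (x k)).
have /choice[B BP] : forall nm : nat * nat, exists B : set (Cp X Y),
    [/\ finite_set B, B `<=` A &
     forall x : {ptws 'I_nm.1 -> X}, exists2 g, B g & close (E nm.2) _ x g].
  case=> n m /=.
  have cXn : compact [set: {ptws 'I_n -> X}].
    have := @tychonoff 'I_n (fun=> X) (fun=> setT) (fun=> cX).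
    by congr (compact _); apply/seteqP.
  move/compact_near_coveringP: cXn => cover.
  (* Along [F], a set eventually contains any given finite part of [A]; the near-covering form of
     compactness then turns local approximants into one finite [B] serving all tuples. *)
  pose F := filter_from [set B : set (Cp X Y) | finite_set B /\ B `<=` A]
                        (fun B => [set B' | B `<=` B']).
  have FF : Filter F.
    apply: filter_from_filter; first by exists set0; split.
    move=> B C [Bf BA] [Cf CA]; exists (B `|` C).
      by split; [rewrite finite_setU|rewrite subUset].
    by move=> D /=; rewrite subUset.
  have [|B [Bfin BA] Bc] := cover _ F
      (fun B x => exists2 g, B g & close (E m) n x g) FF.
    move=> x _.
    pose D := split_ent (split_ent (E m)).
    have Dx k : \forall g \near f, D (ev f (x k), ev g (x k)).
      have entD : entourage D by exact/entourage_split_ent/entourage_split_ent.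
      have := @Cp_eval_continuous X Y (x k) f _ (nbhs_entourage _ entD).
      by apply: (@filterS _ (nbhs f)) => g /xsectionP.
    (* A single [g] in [A] is close to [f] at all coordinates of [x], hence, by continuity of both,
       at those of nearby tuples. *)
    have [g [Ag gx]] := clAf _ (filter_forall (nbhs_filter f) Dx).
    have Ex k : \forall y \near x, E m (ev f (y k), ev g (y k)).
      exact: (@proj_continuous 'I_n (fun=> X) k x _
        (near_entourage2 (entE m) (@CpP _ _ f) (@CpP _ _ g) (gx k))).
    exists ([set y | close (E m) n y g], [set B | [set g] `<=` B]).
      split=> /=; last by exists [set g] => //; split=> // _ ->.
      exact: (filter_forall (nbhs_filter x) Ex).
    by move=> [y C] /= [yg gC]; exists g => //; exact: gC.
  exists B; split=> // x; exact: (Bc B).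
exists (\bigcup_nm B nm); split.
- by move=> g [nm _]; have [_ + _] := BP nm; exact.
- apply: bigcup_countable => // nm _.
  by apply: finite_set_countable; have [] := BP nm.
move=> U /nbhs_Cp[s [D [/Ebase[m EmD] sDU]]].
(* The finite list [s] of test points is read as one point of a finite power of [X]. *)
have [_ _ /(_ (tnth (in_tuple s)))[g Bg gs]] := BP (size s, m).
exists g; split; first by exists (size s, m).
apply: sDU => x; rewrite -[x \in s]/(x \in in_tuple s) => /tnthP[i ->].
by apply: EmD; exact: gs.
Qed.

(** The uniformity is a supremum of countably many, each generated by one entourage: agreement at
    coordinate [n]. *)
Lemma cantor_countable_uniformity : countable_uniformity cantor_space.
Proof.
have Ict : countable [set: nat] by exact: countableP.
pose T (n : nat) : Uniform (nat -> bool) :=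
  Uniform.class (initial_topology (@proj nat (fun=> bool) n)).
apply: (@countable_sup_ent (nat -> bool : choiceType) nat T Ict) => n.
exists [set [set fg | fg.1 n = fg.2 n]]; split.
- exact: countable1.
- move=> _ ->; exists [set bc | bc.1 = bc.2] => //.
  by move=> _ [b _ <-].
- move=> P [Q entQ QP]; eexists; first by reflexivity.
  move=> [f g] /= fg; apply: QP => /=; apply: entQ.
  by exists (f n) => //; congr pair.
Qed.

(** * Neighbourhoods and compactness in well-orders *)

Definition well_ordered d (T : orderType d) : Prop :=
  forall A : set T, A !=set0 -> exists2 x, A x & forall y, A y -> x <= y.

Lemma well_ordered_succ d (T : orderType d) :
  well_ordered T -> well_ordered (order_succ T).
Proof.
move=> wo A [a Aa]; have [[x Ax]|noSome] := pselect (exists x, A (Some x)).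
  have [|m Am mmin] := wo [set x | A (Some x)]; first by exists x.
  by exists (Some m) => // -[y|] //; exact: mmin.
exists a => // -[y Ay|_]; first by case: noSome; exists y.
by case: a Aa.
Qed.

Section well_ordered_topology.
Context d (T : orderType d).
Hypothesis wo : well_ordered T.
Implicit Types (x y z : order_topology T) (U : set (order_topology T)).

(** Keeping the endpoint above a prescribed [w] allows such intervals for different functions to be
    nested. *)
Lemma nbhs_left_itv x U w : nbhs x U -> w < x ->
  exists2 y, w <= y < x & forall z, y < z <= x -> U z.
Proof.
rewrite order_nbhs_itv => -[i [oi xi] iU] wx.
case: i oi xi iU => [] [[] l|[]] [[] r|[]] //= _; rewrite in_itv /=.
- move=> /andP[lx xr] iU; exists (Order.max w l).
    by rewrite le_max lexx /= gt_max wx.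
  move=> z /andP[]; rewrite gt_max => /andP[_ lz] zx.
  by apply: iU; rewrite /= in_itv /= lz (le_lt_trans zx).
- move=> /andP[lx _] iU; exists (Order.max w l).
    by rewrite le_max lexx /= gt_max wx.
  move=> z /andP[]; rewrite gt_max => /andP[_ lz] zx.
  by apply: iU; rewrite /= in_itv /= lz.
- move=> xr iU; exists w; first by rewrite lexx.
  by move=> z /andP[_ zx]; apply: iU; rewrite /= in_itv /= (le_lt_trans zx).
- move=> _ iU; exists w; first by rewrite lexx.
  by move=> z /andP[_ zx]; apply: iU; rewrite /= in_itv.
Qed.

(** Unless [x] is the maximum, this is the open ray below the immediate successor of [x]. *)
Lemma lray_closed_open x : open [set y | y <= x].
Proof.
have [[w xw]|xmax] := pselect (exists w, x < w); last first.
  rewrite (_ : mkset _ = setT); first exact: openT.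
  apply/seteqP; split=> // y _ /=; rewrite leNgt.
  by apply/negP => xy; apply: xmax; exists y.
have [|s xs smin] := wo (A := [set w | x < w]); first by exists w.
rewrite (_ : mkset _ = `]-oo, s[%classic); first exact: lray_open.
apply/seteqP; split=> [y yx|y]; rewrite /= in_itv /= ?(le_lt_trans yx)//.
move=> ys.
by rewrite leNgt; apply/negP => /smin; rewrite leNgt ys.
Qed.

Lemma nbhs_wellP x U : nbhs x U <->
  U x /\ ((exists w, w < x) -> exists2 y, y < x & forall z, y < z <= x -> U z).
Proof.
split=> [Ux|[Ux]].
  split=> [|[w wx]]; first exact: nbhs_singleton.
  by have [y /andP[_ yx] yU] := nbhs_left_itv Ux wx; exists y.
have xle : nbhs x [set y | y <= x].
  by apply: open_nbhs_nbhs; split; [exact: lray_closed_open|exact: lexx].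
have [wx /(_ wx)[y yx yU]|nw _] := pselect (exists w, w < x).
  have ygt : nbhs x `]y, +oo[%classic.
    by apply: open_nbhs_nbhs; split; [exact: rray_open|rewrite /= in_itv /= yx].
  apply: filterS2 xle ygt => z /= zx; rewrite in_itv /= andbT => yz.
  by apply: yU; rewrite yz.
apply: filterS xle => z /=; rewrite le_eqVlt => /predU1P[->//|zx].
by case: nw; exists z.
Qed.

(* An ultrafilter converges to the least [x] such that it contains
   [set y | y <= x]. *)
Lemma well_ordered_compact (t : T) : (forall x : T, x <= t) ->
  compact [set: order_topology T].
Proof.
move=> tmax; rewrite compact_ultra => F FU _.
have [|x Fx xmin] := wo (A := [set x | F [set y | y <= x]]).
  by exists t; apply: filterS filterT => y _; exact: tmax.
exists x; split=> // U /nbhs_wellP[Ux].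
have [wx /(_ wx)[y yx yU]|nw _] := pselect (exists w, w < x).
  (* Minimality of [x] excludes the ray up to [y] from [F], so its complement belongs to [F]. *)
  have [/xmin|] := in_ultra_setVsetC [set z | z <= y] FU.
    by rewrite leNgt yx.
  apply: filterS2 Fx => z /= zx; rewrite /setC /= => /negP; rewrite -ltNge => yz.
  by apply: yU; rewrite yz.
apply: filterS Fx => z /=; rewrite le_eqVlt => /predU1P[->//|zx].
by case: nw; exists z.
Qed.

End well_ordered_topology.

(** * Cantor-valued continuous functions on $\omega_1$ *)

Lemma cantor_cvgP (X : Type) (F : set_system X) (f : X -> cantor_space)
    (a : cantor_space) : Filter F ->
  f @ F --> a <-> forall n, \forall x \near F, f x n = a n.
Proof.
move=> FF; split=> [fa n|fa].
  have /fa : nbhs a [set b : cantor_space | b n = a n].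
    apply: (@proj_continuous nat (fun=> bool) n a [set a n]).
    exact: discrete_set1.
  exact.
apply/(@pointwise_cvgP nat bool (f @ F) a) => n U Un.
by apply: filterS (fa n) => x /= ->; exact: nbhs_singleton.
Qed.

Lemma omega1_well_ordered : well_ordered omega1.
Proof. exact: omega1_min. Qed.

(** Otherwise [B] and the countable initial segments below its points would cover $\omega_1$. *)
Lemma omega1_countable_bounded (B : set omega1) :
  countable B -> exists x, forall b, B b -> b < x.
Proof.
move=> Bct; apply: contrapT => nB; apply: omega1_uncountable.
have : countable (\bigcup_(lt in [set: bool])
    if lt then \bigcup_(b in B) [set y | y < b] else B).
  apply: bigcup_countable; first exact: countableP.
  move=> [] _ //; apply: bigcup_countable => // b _.
  exact: omega1_countable_initial.
apply/sub_countable/subset_card_le => x _.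
have /existsNP[b /not_implyP[Bb /negP]] := (forallNP _).2 nB x.
rewrite -leNgt le_eqVlt => /predU1P[->|xb]; first by exists false.
by exists true => //; exists b.
Qed.

Lemma omega1_unbounded (x : omega1) : exists y, x < y.
Proof.
by have [y ylt] := omega1_countable_bounded (countable1 x); exists y; exact: ylt.
Qed.

Local Notation W := (order_topology omega1).
Local Notation W1 := (order_topology (order_succ omega1)).

Section eventually_constant.
Variables (f : W -> cantor_space).
Hypothesis fcont : continuous f.

Lemma cantor_continuous_near (x : W) n : \forall y \near x, f y n = f x n.
Proof. exact: (cantor_cvgP _ _ _).1 (@fcont x) n. Qed.

Lemma left_constant (x w : W) n : w < x ->
  exists2 y, w <= y < x & forall z, y < z <= x -> f z n = f x n.
Proof. exact: nbhs_left_itv (cantor_continuous_near x n). Qed.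

(* Otherwise some increasing sequence jumps at every step, contradicting
   continuity at its supremum. *)
Lemma eventually_constant n : exists y : W, forall z, y < z -> f z n = f y n.
Proof.
apply: contrapT => /forallNP nconst.
have /choice[nx nxP] (y : W) : exists z : W, y < z /\ f z n <> f y n.
  by have /existsNP[z /not_implyP[yz fz]] := nconst y; exists z.
have [x0 _] : exists x : W, True.
  apply: contrapT => /forallNP noW; apply: omega1_uncountable.
  rewrite (_ : setT = set0) ?countable0//.
  by apply/seteqP; split=> // x _; exact: (noW x).
pose a k := iter k nx x0.
have aS k : a k < a k.+1 by have [] := nxP (a k).
have [|x xub xmin] := @omega1_min [set x | forall k, a k < x].
  have [|x xP] := omega1_countable_bounded (B := range a).
    exact: sub_countable (card_image_le _ _) _.
  by exists x => k; apply: xP; exists k.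
have [y /andP[_ yx] fy] := left_constant n (xub 0%N).
have /existsNP[k /negP] : ~ forall k, a k < y.
  by move=> /xmin; rewrite leNgt yx.
rewrite -leNgt => yk.
have yk1 := le_lt_trans yk (aS k); have yk2 := lt_trans yk1 (aS k.+1).
(* Both [a k.+1] and [a k.+2] lie in the interval up to the supremum [x] on which coordinate [n] of
   [f] is constant. *)
have [_] := nxP (a k.+1); apply.
by rewrite -[nx _]/(a k.+2) !fy ?yk1 ?yk2 // ltW //; exact: xub.
Qed.

End eventually_constant.

(** * The jump map, a continuous injection *)

Definition covers (x y : omega1) : Prop := y < x /\ forall z, z < x -> z <= y.

(* [x] itself at limit points and at the least element. *)
Definition pred_or_self (x : omega1) : omega1 := xget x (covers x).

Lemma pred_or_selfP x :
  covers x (pred_or_self x) \/ pred_or_self x = x /\ ~ exists y, covers x y.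
Proof.
rewrite /pred_or_self; case: xgetP => [y _|nc]; first by left.
by right; split=> // -[y]; exact: nc.
Qed.

Lemma covers_uniq x y z : covers x y -> covers x z -> y = z.
Proof.
move=> [yx ymax] [zx zmax]; apply/le_anti.
by rewrite ymax // zmax.
Qed.

(* Sends [f] to its jumps: [f x - f (x - 1)] at successors, [f 0] at the least
   element and [0] at limits, including the top. *)
Definition jump (f : W -> cantor_space) : W1 -> cantor_space := fun t n =>
  if t is Some x then
    if `[< exists y, y < x >] then f x n (+) f (pred_or_self x) n else f x n
  else false.

Arguments jump : simpl never.

(** The intermediate [y1] forces a predecessor of [z] to stay above [y0], where [f] is constant, so
    the two terms cancel. *)
Lemma jump_constant f n (y0 y1 z : omega1) : y0 < y1 -> y1 < z ->
  (forall t, y0 < t <= z -> f t n = f z n) -> jump f (Some z) n = false.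
Proof.
move=> y01 yz fz; rewrite /jump asboolT; last by exists y1.
rewrite fz ?addbb //; case: (pred_or_selfP z) => [[pz pmax]|[-> _]]; last first.
  by rewrite lexx (lt_trans y01).
by rewrite (lt_le_trans y01) ?pmax //= ltW.
Qed.

Lemma continuous_jump f : continuous f -> continuous (jump f).
Proof.
move=> fcont t; apply/(cantor_cvgP _ _ (nbhs_filter t)) => n.
have wo1 := well_ordered_succ omega1_well_ordered.
apply/(nbhs_wellP wo1); split=> // -[[w|//] wt]; last first.
  by case: t wt.
case: t wt => [x|_] /=; last first.
  have [y0 fy0] := eventually_constant fcont n.
  have [y1 y01] := omega1_unbounded y0.
  exists (Some y1) => // -[z|//] /andP[/= y1z _].
  rewrite /= (@jump_constant f n y0 y1) // => u /andP[y0u _].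
  by rewrite !fy0 // (lt_trans y01).
move=> wx; have [[p [px pmax]]|nc] := pselect (exists y, covers x y).
  (* A successor point is isolated: only [x] lies above [p] and up to [x]. *)
  exists (Some p) => // -[z|] /andP[pz zx] //.
  suff -> : z = x by [].
  apply/le_anti/andP; split; first exact: zx.
  by rewrite leNgt; apply/negP => /pmax; rewrite leNgt => /negP; apply.
have [y0 /andP[_ y0x] fy0] := left_constant fcont n (wx : w < x).
have [y1 y01 y1x] : exists2 y1, y0 < y1 & y1 < x.
  apply: contrapT => ny1; apply: nc; exists y0; split=> // z zx.
  by rewrite leNgt; apply/negP => y0z; apply: ny1; exists z.
have jump0 z : y1 < z <= x -> jump f (Some z) n = false.
  move=> /andP[y1z zx]; apply: (@jump_constant f n y0 y1) => // u /andP[y0u uz].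
  by rewrite !fy0 ?(lt_trans y01 y1z) ?y0u //= (le_trans uz).
exists (Some y1) => // -[z|] /andP[y1z zx] //=.
by rewrite !jump0 ?y1x ?lexx //; apply/andP.
Qed.

(** At a least point of disagreement, a common predecessor value cancels from the jumps; at a limit,
    each coordinate of both values is already attained at a common earlier point. *)
Lemma jump_inj f g : continuous f -> continuous g -> jump f = jump g -> f = g.
Proof.
move=> fc gc jfg; apply/funext => x; apply: contrapT => fgx.
have [|{fgx}x fgx xmin] := @omega1_min [set x | f x <> g x]; first by exists x.
apply: fgx; apply/funext => n.
have fg y : y < x -> f y = g y.
  by move=> yx; apply: contrapT => /xmin; rewrite leNgt yx.
have := congr1 (fun h => h (Some x) n) jfg; rewrite /jump.
case: asboolP => [[w wx]|//].
case: (pred_or_selfP x) => [[px _]|[_ nc] _].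
  by rewrite (fg _ px); exact: addIb.
have [y /andP[_ yx] fy] := left_constant fc n wx.
have [z /andP[yz zx] gz] := left_constant gc n yx.
have [u zu ux] : exists2 u, z < u & u < x.
  apply: contrapT => nu; apply: nc; exists z; split=> // u ux.
  by rewrite leNgt; apply/negP => zu; apply: nu; exists u.
by rewrite -(fy u) ?(le_lt_trans yz zu) ?ltW // -(gz u) ?zu ?ltW // fg.
Qed.

Definition jumpC (f : Cp W cantor_space) : Cp W1 cantor_space :=
  exist _ (jump (set_val f)) (mem_set (continuous_jump (@CpP _ _ f))).

(** Each value of the jump function depends on at most two values of [f]. *)
Lemma jumpC_continuous : continuous jumpC.
Proof.
apply: continuous_comp_initial => f.
have near_eval (x : W) n : \forall g \near f,
    (set_val g : W -> cantor_space) x n = (set_val f : W -> cantor_space) x n.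
  exact: (cantor_cvgP _ _ (nbhs_filter f)).1 (@Cp_eval_continuous _ _ x f) n.
apply/(pointwise_cvgP _ (fmap_filter _ (nbhs_filter f))) => t.
apply/(cantor_cvgP _ _ (nbhs_filter f)) => n.
case: t => [x|]; last exact: filterE.
apply: filterS2 (near_eval x n) (near_eval (pred_or_self x) n) => g gx gpx.
change (jump (set_val g) (Some x) n = jump (set_val f) (Some x) n).
by rewrite /jump gx gpx.
Qed.

Lemma jumpC_injective : injective jumpC.
Proof.
move=> f g /(congr1 set_val) jfg; apply: val_inj.
by apply: jump_inj jfg; exact: CpP.
Qed.

(** * Comparing the tightness of the two function spaces *)

Definition tail_indicator (a : W) : W -> cantor_space := fun x _ => a < x.

Lemma continuous_tail_indicator a : continuous (tail_indicator a).
Proof.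
move=> x; apply/(cantor_cvgP _ _ (nbhs_filter x)) => n.
rewrite /tail_indicator; case: (ltP a x) => [ax|xa].
  have : nbhs x `]a, +oo[%classic.
    by apply: open_nbhs_nbhs; split; [exact: rray_open|rewrite /= in_itv /= ax].
  by apply: filterS => y /=; rewrite in_itv /= andbT.
have : nbhs x [set y | y <= x].
  apply: open_nbhs_nbhs; split; last exact: lexx.
  exact: lray_closed_open omega1_well_ordered _.
by apply: filterS => y /= yx; apply/negbTE; rewrite -leNgt (le_trans yx).
Qed.

Definition tail_indicatorC (a : W) : Cp W cantor_space :=
  exist _ (tail_indicator a) (mem_set (@continuous_tail_indicator a)).

Lemma Cp_omega1_not_countably_tight : ~ countably_tight (Cp W cantor_space).
Proof.
pose o : cantor_space := fun=> false.
pose zero : Cp W cantor_space :=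
  exist _ (fun=> o) (mem_set (@cst_continuous W cantor_space o)).
move=> /(_ (range tail_indicatorC) zero)[|B [Btail Bct clB]].
  move=> U /nbhs_Cp[s [E [entE sEU]]].
  have [|a aub] := @omega1_countable_bounded [set` s].
    exact/finite_set_countable.
  (* A tail starting beyond the finite set [s] has an indicator vanishing on [s]. *)
  exists (tail_indicatorC a); split; first by exists a.
  apply: sEU => x xs /=; rewrite set_valE /=.
  rewrite (_ : tail_indicator a x = o); first exact: entourage_refl.
  by apply/funext => n; apply/negbTE; rewrite -leNgt ltW //; exact: aub.
have /choice[c cP] (g : Cp W cantor_space) :
    exists a, B g -> tail_indicatorC a = g.
  have [/Btail[a _ ag]|nB] := pselect (B g); first by exists a.
  by have [a _] := omega1_countable_bounded (countable0 omega1); exists a.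
(* All indicators in [B] take the value [true] at a point [x] beyond their countably many
   thresholds, so evaluation at [x] separates them from zero. *)
have [|x xub] := @omega1_countable_bounded (c @` B).
  exact: sub_countable (card_image_le _ _) _.
have [|g [Bg]] := clB [set g | (set_val g : W -> cantor_space) x 0%N = false].
  rewrite set_valE; have evx := @Cp_eval_continuous W cantor_space x zero.
  exact: (cantor_cvgP _ _ (nbhs_filter zero)).1 evx 0%N.
by rewrite /= -(cP g Bg) set_valE /= /tail_indicator xub //; exists g.
Qed.

Lemma Cp_omega1_succ_countably_tight : countably_tight (Cp W1 cantor_space).
Proof.
apply: Cp_countably_tight cantor_countable_uniformity.
apply: (well_ordered_compact (well_ordered_succ omega1_well_ordered) (t := None)).
by case.
Qed.

Theorem mainTheorem3 :
  (exists F : Cp (order_topology omega1) cantor_space ->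
              Cp (order_topology (order_succ omega1)) cantor_space,
     continuous F /\ injective F) /\
  ~ (exists S : set (Cp (order_topology (order_succ omega1)) cantor_space),
       homeomorphic (Cp (order_topology omega1) cantor_space) S).
Proof.
split.
  by exists jumpC; split; [exact: jumpC_continuous|exact: jumpC_injective].
case=> S /(countably_tight_subspace Cp_omega1_succ_countably_tight).
exact: Cp_omega1_not_countably_tight.
Qed.
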